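(* Consider a two-port port-Hamiltonian system $$\begin{aligned} \dot{x}_1 &= J_1(x_1,x_2)e_1 - R_1(x_1,x_2)e_1 + G_1u_1,\\ \dot{x}_2 &= J_2(x_1,x_2)e_2 - R_2(x_1,x_2)e_2 + G_2(x_1,x_2)u_2,\\ y_1 &= G_1^\top e_1, \qquad e_1=\frac{\partial H}{\partial x_1}(x_1,x_2),\\ y_2 &= G_2^\top(x_1,x_2)e_2, \qquad e_2=\frac{\partial H}{\partial x_2}(x_1,x_2), \end{aligned}$$ where, for $i=1,2$, $J_i(x_1,x_2)=-J_i(x_1,x_2)^\top$ and $e_i^\top R_i(x_1,x_2)e_i\ge 0$ for all $(x_1,x_2)$ and all $e_i$, $G_1$ is an invertible constant matrix, and the partial Hessian $\frac{\partial^2 H}{\partial x_1^2}(x_1,x_2)$ has full rank everywhere. Consider a Carnot cycle of this system with port-1 values $e_1^h$ and $e_1^c$ and switching times $0\le\tau_1\le\tau_2\le\tau_3\le\tau$, and let $\Delta^h x_1=x_1(\tau_1)-x_1(0)$ and $\Delta^c x_1=x_1(\tau_3)-x_1(\tau_2)$ be the changes of $x_1$ during the two isothermals. Then $\Delta^h x_1+\Delta^c x_1=0$, and the total energy delivered to the environment via port 2 satisfies $$-\int_0^\tau y_2^\top(t)u_2(t)\,dt \;\le\; (e_1^h)^\top\Delta^h x_1+(e_1^c)^\top\Delta^c x_1=(e_1^h-e_1^c)^\top\Delta^h x_1,$$ with equality if $R_1=0$ and $R_2=0$. Moreover, if $R_1=0$, $R_2=0$, $x_1$ is scalar and $e_1^h\Delta^h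 x_1\neq 0$, then the efficiency of the Carnot cycle is $$\frac{-\int_0^\tau y_2^\top(t)u_2(t)\,dt}{e_1^h\Delta^h x_1}=\frac{e_1^h\Delta^h x_1+e_1^c\Delta^c x_1}{e_1^h\Delta^h x_1}=1-\frac{e_1^c}{e_1^h}.$$
   Context: The state is $x=(x_1,x_2)$, with $x_1\in\mathbb{R}^{n_1}$, $x_2\in\mathbb{R}^{n_2}$, ranging over a state space $\mathcal{X}$, an open subset of $\mathbb{R}^{n_1}\times\mathbb{R}^{n_2}$. The Hamiltonian $H:\mathcal{X}\to\mathbb{R}$ and the matrix-valued maps $J_1,J_2,R_1,R_2,G_2$ (of compatible sizes) are smooth. The vectors $u_1,y_1$ are the input and output of port 1, and $u_2,y_2$ are the input and output of port 2. A Carnot cycle is a (continuous) solution $x(t)=(x_1(t),x_2(t))$, $t\in[0,\tau]$, of the system for some input functions $u_1,u_2$, with $x(\tau)=x(0)$, such that for some times $0\le\tau_1\le\tau_2\le\tau_3\le\tau$ and some constant vectors $e_1^h,e_1^c\in\mathbb{R}^{n_1}$: (1) on $[0,\tau_1]$ (''isothermal''), $e_1=\frac{\partial H}{\partial x_1}(x_1(t),x_2(t))$ is constant, equal to $e_1^h$; (2) on $[\tau_1,\tau_2]$ (''adiabatic''), $x_1(t)$ is constant; (3) on $[\tau_2,\tau_3]$ (''isothermal''), $e_1=\frac{\partial H}{\partial x_1}(x_1(t),x_2(t))$ is constant, equal to $e_1^c$; (4) on $[\tau_3,\tau]$ (''adiabatic''), $x_1(t)$ is constant. The efficiency (for $R_1=0$,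 $R_2=0$, $x_1$ scalar) is the energy delivered to the environment via port 2 over the whole cycle divided by $e_1^h\Delta^h x_1$, the energy supplied to the system at port 1 during the first isothermal. *)

(* Defs.v *)
From HB Require Import structures.
From mathcomp Require Import all_boot all_order all_algebra.
From mathcomp Require Import all_classical all_reals all_analysis.

Set Implicit Arguments.
Unset Strict Implicit.
Unset Printing Implicit Defensive.
Import Order.TTheory GRing.Theory Num.Theory.
Import numFieldNormedType.Exports.

Local Open Scope classical_set_scope.
Local Open Scope ring_scope.

Definition dot (R : realType) (n : nat) (u v : 'cV[R]_n) : R :=
  (u^T *m v) 0 0.

(* C^oo on the open set [X]: every iterated directional derivative of [f] is
   differentiable at every point of [X].  [f] is a total function, but on an
   open [X] this depends only on its values in [X]. *)
Definition smooth_on (R : realType) (V W : normedModType R) (X : set V)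
    (f : V -> W) : Prop :=
  forall (vs : seq V) (x : V), X x ->
    differentiable (foldr (fun v g => 'D_v g) f vs) x.

Section Partials.
Variables (R : realType) (n1 n2 : nat).

Definition dir1 (i : 'I_n1) : 'cV[R]_n1 * 'cV[R]_n2 := (delta_mx i 0, 0).
Definition dir2 (i : 'I_n2) : 'cV[R]_n1 * 'cV[R]_n2 := (0, delta_mx i 0).

Definition grad1 (H : 'cV[R]_n1 * 'cV[R]_n2 -> R)
    (x : 'cV[R]_n1 * 'cV[R]_n2) : 'cV[R]_n1 := \col_i 'D_(dir1 i) H x.
Definition grad2 (H : 'cV[R]_n1 * 'cV[R]_n2 -> R)
    (x : 'cV[R]_n1 * 'cV[R]_n2) : 'cV[R]_n2 := \col_i 'D_(dir2 i) H x.

Definition hess11 (H : 'cV[R]_n1 * 'cV[R]_n2 -> R)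
    (x : 'cV[R]_n1 * 'cV[R]_n2) : 'M[R]_n1 :=
  \matrix_(i, j) 'D_(dir1 i) ('D_(dir1 j) H) x.

End Partials.

(* Two-port port-Hamiltonian system on the open state space [ph_X].  The
   structure maps are total functions; only their values on [ph_X] matter. *)
Record ph_system (R : realType) (n1 n2 m2 : nat) := PhSystem {
  ph_X : set ('cV[R]_n1 * 'cV[R]_n2);
  ph_H : 'cV[R]_n1 * 'cV[R]_n2 -> R;
  ph_J1 : 'cV[R]_n1 * 'cV[R]_n2 -> 'M[R]_n1;
  ph_J2 : 'cV[R]_n1 * 'cV[R]_n2 -> 'M[R]_n2;
  ph_R1 : 'cV[R]_n1 * 'cV[R]_n2 -> 'M[R]_n1;
  ph_R2 : 'cV[R]_n1 * 'cV[R]_n2 -> 'M[R]_n2;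
  ph_G1 : 'M[R]_n1;
  ph_G2 : 'cV[R]_n1 * 'cV[R]_n2 -> 'M[R]_(n2, m2);
  ph_X_open : open ph_X;
  ph_H_smooth : smooth_on ph_X ph_H;
  ph_J1_smooth : smooth_on ph_X ph_J1;
  ph_J2_smooth : smooth_on ph_X ph_J2;
  ph_R1_smooth : smooth_on ph_X ph_R1;
  ph_R2_smooth : smooth_on ph_X ph_R2;
  ph_G2_smooth : smooth_on ph_X ph_G2;
  ph_J1_skew : forall x, ph_X x -> ph_J1 x = - (ph_J1 x)^T;
  ph_J2_skew : forall x, ph_X x -> ph_J2 x = - (ph_J2 x)^T;
  ph_R1_ge0 : forall x, ph_X x -> forall e, 0 <= dot e (ph_R1 x *m e);
  ph_R2_ge0 : forall x, ph_X x -> forall e, 0 <= dot e (ph_R2 x *m e);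
  ph_G1_unit : ph_G1 \in unitmx;
  ph_hess_full : forall x, ph_X x -> \rank (hess11 ph_H x) = n1 }.

Definition ph_e1 (R : realType) (n1 n2 m2 : nat) (S : ph_system R n1 n2 m2) :=
  grad1 (ph_H S).
Definition ph_e2 (R : realType) (n1 n2 m2 : nat) (S : ph_system R n1 n2 m2) :=
  grad2 (ph_H S).

(* [f] is absolutely continuous on [[a, b]], in the form: [f] is the indefinite
   Lebesgue integral of an (entrywise) integrable function. *)
Definition abs_continuous (R : realType) (n : nat) (a b : R)
    (f : R -> 'cV[R]_n) : Prop :=
  exists v : R -> 'cV[R]_n, forall i : 'I_n,
    (@lebesgue_measure R).-integrable `[a, b] (fun s => (v s i 0)%:E) /\
    forall t, t \in `[a, b] ->
      f t i 0 = f a i 0 + \int[@lebesgue_measure R]_(s in `[a, t]) v s i 0.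

(* Solution on [[0, tau]] in the sense of Caratheodory: the inputs are only
   measurable (they may jump at the switching times), the state is absolutely
   continuous (in particular continuous), and the differential equations hold
   at almost every time. *)
Record ph_solution (R : realType) (n1 n2 m2 : nat) (S : ph_system R n1 n2 m2)
    (tau : R) (x1 : R -> 'cV[R]_n1) (x2 : R -> 'cV[R]_n2)
    (u1 y1 : R -> 'cV[R]_n1) (u2 y2 : R -> 'cV[R]_m2) : Prop := PhSolution {
  sol_u1 : forall i, measurable_fun `[0, tau] (fun t => u1 t i 0);
  sol_u2 : forall i, measurable_fun `[0, tau] (fun t => u2 t i 0);
  sol_X : forall t, t \in `[0, tau] -> ph_X S (x1 t, x2 t);
  sol_ac1 : abs_continuous 0 tau x1;
  sol_ac2 : abs_continuous 0 tau x2;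
  sol_eq1 : {ae @lebesgue_measure R, forall t, t \in `[0, tau] ->
    let x := (x1 t, x2 t) in
    is_derive t 1 x1
      (ph_J1 S x *m ph_e1 S x - ph_R1 S x *m ph_e1 S x + ph_G1 S *m u1 t)};
  sol_eq2 : {ae @lebesgue_measure R, forall t, t \in `[0, tau] ->
    let x := (x1 t, x2 t) in
    is_derive t 1 x2
      (ph_J2 S x *m ph_e2 S x - ph_R2 S x *m ph_e2 S x + ph_G2 S x *m u2 t)};
  sol_y1 : forall t, t \in `[0, tau] ->
    y1 t = (ph_G1 S)^T *m ph_e1 S (x1 t, x2 t);
  sol_y2 : forall t, t \in `[0, tau] ->
    y2 t = (ph_G2 S (x1 t, x2 t))^T *m ph_e2 S (x1 t, x2 t) }.

Record carnot_cycle (R : realType) (n1 n2 m2 : nat) (S : ph_system R n1 n2 m2)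
    (tau1 tau2 tau3 tau : R) (e1h e1c : 'cV[R]_n1)
    (x1 : R -> 'cV[R]_n1) (x2 : R -> 'cV[R]_n2)
    (u1 y1 : R -> 'cV[R]_n1) (u2 y2 : R -> 'cV[R]_m2) : Prop := CarnotCycle {
  cc_times : [/\ 0 <= tau1, tau1 <= tau2, tau2 <= tau3 & tau3 <= tau];
  cc_solution : ph_solution S tau x1 x2 u1 y1 u2 y2;
  cc_closed : x1 tau = x1 0 /\ x2 tau = x2 0;
  cc_hot : forall t, t \in `[0, tau1] -> ph_e1 S (x1 t, x2 t) = e1h;
  cc_adiabatic1 : forall t, t \in `[tau1, tau2] -> x1 t = x1 tau1;
  cc_cold : forall t, t \in `[tau2, tau3] -> ph_e1 S (x1 t, x2 t) = e1c;
  cc_adiabatic2 : forall t, t \in `[tau3, tau] -> x1 t = x1 tau3 }.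

(* Energy delivered to the environment through port 2 during [[0, tau]]. *)
Definition delivered2 (R : realType) (m2 : nat) (tau : R)
    (u2 y2 : R -> 'cV[R]_m2) : R :=
  - \int[@lebesgue_measure R]_(t in `[0, tau]) dot (y2 t) (u2 t).

(* [dxh] is the change of [x1] along the hot isothermal, so that the
   denominator is the energy supplied at port 1 along it when [R1 = 0]. *)
Definition efficiency (R : realType) (n1 m2 : nat) (tau : R)
    (e1h dxh : 'cV[R]_n1) (u2 y2 : R -> 'cV[R]_m2) : R :=
  delivered2 tau u2 y2 / dot e1h dxh.

(* Main.v *)
Require Import Defs.
From HB Require Import structures.
From mathcomp Require Import all_boot all_order all_algebra.
From mathcomp Require Import all_classical all_reals all_analysis.
From mathcomp Require Import measurable_realfun.
From mathcomp Require Import lra ring.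
Set Implicit Arguments.
Unset Strict Implicit.
Import Order.TTheory GRing.Theory Num.Theory.
Import numFieldNormedType.Exports.
Local Open Scope classical_set_scope.
Local Open Scope ring_scope.

(** Along a solution, [H (x1 t, x2 t)] is the integral of [e1 . x1' + e2 . x2'],
    and it takes the same value at [0] and [tau].  Skew-symmetry of [J2] turns
    [e2 . x2'] into [y2 . u2 - e2 . R2 e2], so the energy delivered at port 2 is
    the integral of [e1 . x1'] minus the dissipation; the former is
    [e1h . dxh + e1c . dxc] because [x1'] vanishes on the adiabatics.

    As [x1] and [x2] are only absolutely continuous, the chain rule for [H] is
    obtained from a first-order estimate at each single time, globalized by a
    supremum argument; no uniformity in time is needed.  Lebesgue's
    differentiation theorem identifies the densities of [x1] and [x2] with the
    right-hand sides of the differential equations. *)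

Local Notation mu := (@lebesgue_measure _) (only parsing).

(** * From local estimates to identities between integrals *)

(** Let [c] be the supremum of the points [t] with [W a <= W t]. The local hypothesis at [c], used
    to the left, shows that [c] is such a point; used to the right, it would produce a larger one if
    [c < b]. *)
Lemma local_ndecr {R : realType} (a b : R) (W : R -> R) : a <= b ->
  (forall s, s \in `[a, b] -> \forall t \near s, t \in `[a, b] ->
    W (Num.min s t) <= W (Num.max s t)) ->
  W a <= W b.
Proof.
move=> ab Wloc.
pose A := [set t | t \in `[a, b] /\ W a <= W t].
have Aa : A a by rewrite /A /= in_itv /= lexx ab.
have Aub : ubound A b by move=> t [/=]; rewrite in_itv /= => /andP[].
have supA : has_sup A by split; [exists a|exists b].
set c := sup A.
have ac : a <= c by apply: ub_le_sup => //; exists b.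
have cb : c <= b by apply: ge_sup => //; exists a.
have cab : c \in `[a, b] by rewrite in_itv /= ac cb.
have /nbhs_ballP[d /= d0 dW] := Wloc c cab.
have [u Au] := sup_adherent d0 supA; rewrite -/c => cu.
have uc : u <= c by apply: ub_le_sup => //; exists b.
have Wc : W a <= W c.
  case: Au => uab Wu; apply: (le_trans Wu).
  have := dW u; rewrite /ball /= => /(_ _ uab).
  by rewrite (min_idPr uc) (max_idPl uc); apply; rewrite ger0_norm; lra.
have [bc|cltb] := leP b c; first by have -> : b = c by apply/eqP; rewrite eq_le bc cb.
(* A point beyond [c], still inside the ball of radius [d] and not past [b]. *)
pose t := Num.min b (c + d / 2).
have ct : c < t by rewrite lt_min cltb /=; lra.
have tb : t <= b by rewrite ge_min lexx.
have td : t <= c + d / 2 by rewrite ge_min lexx orbT.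
have tab : t \in `[a, b] by rewrite in_itv /= tb andbT; lra.
have At : A t.
  split => //; apply: (le_trans Wc).
  have := dW t; rewrite /ball /= => /(_ _ tab).
  rewrite (min_idPl (ltW ct)) (max_idPr (ltW ct)); apply.
  by rewrite ltr0_norm; lra.
have : t <= c by apply: ub_le_sup => //; exists b.
by rewrite leNgt ct.
Qed.

Lemma integrable_sub_itv {R : realType} {a b p r : R} {f : R -> R} :
  a <= p -> r <= b -> mu.-integrable `[a, b] (fun t => (f t)%:E) ->
  mu.-integrable `[p, r] (fun t => (f t)%:E).
Proof.
move=> ap rb; apply: integrableS => //.
by apply: subset_itv; rewrite bnd_simp.
Qed.

Lemma Rintegral_cc_split {R : realType} (a p r : R) (f : R -> R) :
  a <= p -> p <= r -> mu.-integrable `[a, r] (fun t => (f t)%:E) ->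
  \int[mu]_(t in `[a, r]) f t =
  \int[mu]_(t in `[a, p]) f t + \int[mu]_(t in `[p, r]) f t.
Proof.
move=> ap pr fint; apply/eqP; rewrite addrC -subr_eq; apply/eqP.
(* The difference is an integral over an interval open at [p]; adding this single point does not
   change it. *)
rewrite Rintegral_itvB ?bnd_simp// Rintegral_itv_obnd_cbnd//.
apply: integrableS fint => //.
by apply: subset_itv; rewrite bnd_simp.
Qed.

Lemma Rintegral_increment {R : realType} (a b p r : R) (x v : R -> R) :
  mu.-integrable `[a, b] (fun t => (v t)%:E) ->
  (forall t, t \in `[a, b] -> x t = x a + \int[mu]_(z in `[a, t]) v z) ->
  a <= p -> p <= r -> r <= b ->
  x r - x p = \int[mu]_(z in `[p, r]) v z.
Proof.
move=> vint xE ap pr rb.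
have [pab rab] : p \in `[a, b] /\ r \in `[a, b] by rewrite !in_itv /=; split; lra.
rewrite (xE r)// (xE p)// (@Rintegral_cc_split _ a p r)//; first by ring.
exact: integrable_sub_itv vint.
Qed.

(* The neighbourhood of [s] may depend on [s]: the hypothesis says that
   [e * int q -+ (h - int w)] is locally nondecreasing at every point, which
   [local_ndecr] globalizes. *)
Lemma Rintegral_of_local_bound {R : realType} (a b : R) (h w q : R -> R) :
  a <= b ->
  mu.-integrable `[a, b] (fun t => (w t)%:E) ->
  mu.-integrable `[a, b] (fun t => (q t)%:E) ->
  (forall e, 0 < e -> forall s, s \in `[a, b] ->
    \forall t \near s, t \in `[a, b] ->
      let p := Num.min s t in let r := Num.max s t in
      `|h r - h p - \int[mu]_(z in `[p, r]) w z|
        <= e * \int[mu]_(z in `[p, r]) q z) ->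
  h b - h a = \int[mu]_(t in `[a, b]) w t.
Proof.
move=> ab wint qint loc.
pose I (f : R -> R) t := \int[mu]_(z in `[a, t]) f z.
have I0 f : I f a = 0 by rewrite /I set_itv1 Rintegral_set1.
(* The sign [k] treats the upper and the lower bound at once; [e] is sent to 0 afterwards. *)
have key e k : 0 < e -> (k = 1 \/ k = -1) ->
    k * (h b - h a - I w b) <= e * I q b.
  move=> e0 k1.
  have := @local_ndecr _ a b
    (fun t => e * I q t - k * (h t - I w t)) ab.
  rewrite !I0 mulr0 => ndecr.
  suff : 0 - k * (h a - 0) <= e * I q b - k * (h b - I w b) by lra.
  apply: ndecr => s sab; have := loc e e0 s sab.
  apply: filterS => t + tab => /(_ tab) /=.
  set p := Num.min s t; set r := Num.max s t => bound.
  move: sab tab; rewrite !in_itv /= => /andP[as_ sb] /andP[at_ tb].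
  have ap : a <= p by rewrite le_min as_ at_.
  have rb : r <= b by rewrite ge_max sb tb.
  have pr : p <= r by rewrite le_max ge_min lexx.
  have split_at f : mu.-integrable `[a, b] (fun t => (f t)%:E) ->
      I f r = I f p + \int[mu]_(z in `[p, r]) f z.
    by move=> fint; apply: Rintegral_cc_split => //; exact: integrable_sub_itv fint.
  rewrite (split_at w) // (split_at q) //.
  move: bound; rewrite ler_norml => /andP[].
  by case: k1 => ->; lra.
apply/eqP; rewrite -subr_eq0 -normr_le0.
apply/ler_addgt0Pr => e e0; rewrite add0r.
(* [key] is applied to [e / (|I q b| + 1)], so that the total error is at most [e]; the [+ 1] keeps
   the denominator positive. *)
have q1 : 0 < `|I q b| + 1 by rewrite ltr_wpDl.
have := key (e / (`|I q b| + 1)) 1; have := key (e / (`|I q b| + 1)) (-1).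
rewrite !divr_gt0// => /(_ isT (or_intror erefl)) + /(_ isT (or_introl erefl)).
have : e / (`|I q b| + 1) * I q b <= e.
  rewrite mulrAC ler_pdivrMr // ler_pM2l //.
  by rewrite (le_trans (ler_norm _)) // lerDl.
by rewrite -/(I w b) ler_norml; lra.
Qed.

(** * Continuity, integrability and finite sums *)

Lemma within_continuous_bounded {R : realType} (a b : R) (g : R -> R) :
  {within `[a, b], continuous g} -> [bounded g x | x in `[a, b]].
Proof.
move=> gc.
have /compact_bounded[M [Mreal HM]] :=
  continuous_compact gc (@segment_compact R a b).
by exists M; split => // N MN t tab; apply: (HM N MN); exists t.
Qed.

Lemma within_continuous_measurable {R : realType} (a b : R) (g : R -> R) :
  {within `[a, b], continuous g} -> measurable_fun `[a, b] g.
Proof. by move=> gc; exact: subspace_continuous_measurable_fun. Qed.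

Lemma integrable_continuousM {R : realType} (a b : R) (g v : R -> R) :
  {within `[a, b], continuous g} ->
  mu.-integrable `[a, b] (fun t => (v t)%:E) ->
  mu.-integrable `[a, b] (fun t => (g t * v t)%:E).
Proof.
move=> gc vint.
rewrite (_ : (fun t => _) = (EFin \o g) \* (fun t => (v t)%:E))%E//.
apply: integrableMr => //; first exact: within_continuous_measurable.
exact: within_continuous_bounded.
Qed.

Lemma integrable_sumr d (T : measurableType d) {R : realType}
    (m : {measure set T -> \bar R})
    (D : set T) (I : Type) (s : seq I)
    (f : I -> T -> R) : measurable D ->
  (forall i, m.-integrable D (fun t => (f i t)%:E)) ->
  m.-integrable D (fun t => (\sum_(i <- s) f i t)%:E).
Proof.
move=> mD fint; under eq_fun do rewrite -sumEFin.
exact: integrable_sum.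
Qed.

Lemma Rintegral_sum d (T : measurableType d) {R : realType}
    (m : {measure set T -> \bar R})
    (D : set T) (I : Type) (s : seq I)
    (f : I -> T -> R) : measurable D ->
  (forall i, m.-integrable D (fun t => (f i t)%:E)) ->
  \int[m]_(t in D) (\sum_(i <- s) f i t) =
  \sum_(i <- s) \int[m]_(t in D) f i t.
Proof.
move=> mD fint; elim: s => [|i s IH].
  rewrite big_nil; under eq_Rintegral do rewrite big_nil.
  by rewrite Rintegral_cst // mul0r.
rewrite big_cons -IH -RintegralD//; [|exact: fint|exact: integrable_sumr].
by apply: eq_Rintegral => t _; rewrite big_cons.
Qed.

Lemma integrable_normr d (T : measurableType d) {R : realType}
    (m : {measure set T -> \bar R})
    (D : set T) (f : T -> R) : measurable D ->
  m.-integrable D (fun t => (f t)%:E) ->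
  m.-integrable D (fun t => `|f t|%:E).
Proof. by move=> mD /integrable_abse; apply: eq_integrable. Qed.

Lemma integrable_scaler d (T : measurableType d) {R : realType}
    (m : {measure set T -> \bar R})
    (D : set T) (k : R) (f : T -> R) :
  measurable D -> m.-integrable D (fun t => (f t)%:E) ->
  m.-integrable D (fun t => (k * f t)%:E).
Proof.
by move=> mD fint; have := integrableZl mD k fint; apply: eq_integrable.
Qed.

Lemma integrable_addr d (T : measurableType d) {R : realType}
    (m : {measure set T -> \bar R})
    (D : set T) (f g : T -> R) :
  measurable D -> m.-integrable D (fun t => (f t)%:E) ->
  m.-integrable D (fun t => (g t)%:E) ->
  m.-integrable D (fun t => (f t + g t)%:E).
Proof.
by move=> mD fint gint; have := integrableD mD fint gint; apply: eq_integrable.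
Qed.

Lemma integrable_subr d (T : measurableType d) {R : realType}
    (m : {measure set T -> \bar R})
    (D : set T) (f g : T -> R) :
  measurable D -> m.-integrable D (fun t => (f t)%:E) ->
  m.-integrable D (fun t => (g t)%:E) ->
  m.-integrable D (fun t => (f t - g t)%:E).
Proof.
by move=> mD fint gint; have := integrableB mD fint gint; apply: eq_integrable.
Qed.

(** * The chain rule for indefinite integrals *)

(** Near [s], two errors arise: the first-order remainder, and the one from freezing [g i] at its
    value in [s]. Both are small multiples of the integral of [\sum_i |v i|] between [s] and [t], so
    this sum serves as [q] in [Rintegral_of_local_bound]. *)
Lemma Rintegral_chain_rule {R : realType} (I : finType) (a b : R)
    (x v g : I -> R -> R) (h : R -> R) : a <= b ->
  (forall i, mu.-integrable `[a, b] (fun t => (v i t)%:E)) ->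
  (forall i t, t \in `[a, b] ->
    x i t = x i a + \int[mu]_(z in `[a, t]) v i z) ->
  (forall i, {within `[a, b], continuous (g i)}) ->
  (forall e, 0 < e -> forall s, s \in `[a, b] ->
    \forall t \near s, t \in `[a, b] ->
      `|h t - h s - \sum_i g i s * (x i t - x i s)|
        <= e * \sum_i `|x i t - x i s|) ->
  h b - h a = \int[mu]_(t in `[a, b]) \sum_i g i t * v i t.
Proof.
move=> ab vint xE gcont loc.
have gvint i := integrable_continuousM (gcont i) (vint i).
apply: (@Rintegral_of_local_bound _ _ _ _ _ (fun t => \sum_i `|v i t|)) => //.
- exact: integrable_sumr.
- by apply: integrable_sumr => // i; exact: integrable_normr.
move=> e e0 s sab.
(* Half of [e] pays for the first-order remainder, half for freezing [g]. *)
have e2 : 0 < e / 2 by rewrite divr_gt0.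
have gnear : \forall t \near s, t \in `[a, b] -> forall i,
    `|g i s - g i t| <= e / 2.
  have : \forall t \near s, forall i, t \in `[a, b] -> `|g i s - g i t| <= e / 2.
    refine (@filter_forall R I
      (fun i t => t \in `[a, b] -> `|g i s - g i t| <= e / 2) (nbhs s) _ _) => i.
    have /subspace_continuousP/(_ s) := gcont i.
    move=> /(_ sab) /cvgrPdist_le /(_ _ e2).
    by apply: filterS.
  by apply: filterS => t H tab i; exact: H.
(* The bound passes from [t] to every [z] between [s] and [t], which is at least as close to [s]. *)
have {}gnear : \forall t \near s, forall z,
    (z \in `[Num.min s t, Num.max s t]) -> z \in `[a, b] -> forall i,
    `|g i s - g i z| <= e / 2.
  case/nbhs_ballP: gnear => d /= d0 dg.
  apply/nbhs_ballP; exists d => //= t; rewrite /ball /= => std z.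
  rewrite in_itv /= ge_min le_max => zst; apply: dg.
  rewrite /ball /=; apply: le_lt_trans std.
  case: (leP s t) zst => st zst.
    by rewrite !ler0_norm ?subr_le0//; move: zst; lra.
  by rewrite !ger0_norm ?subr_ge0//; move: zst; lra.
near=> t.
have hbound : t \in `[a, b] ->
    `|h t - h s - \sum_i g i s * (x i t - x i s)|
      <= e / 2 * \sum_i `|x i t - x i s|.
  by near: t; exact: loc.
have gbound : forall z, z \in `[Num.min s t, Num.max s t] ->
    z \in `[a, b] -> forall i, `|g i s - g i z| <= e / 2.
  by near: t; exact: gnear.
move=> tab; move: gbound; have {}hbound := hbound tab.
set p := Num.min s t; set r := Num.max s t => gbound.
have [ap pr rb] : [/\ a <= p, p <= r & r <= b].
  have := sab; have := tab; rewrite !in_itv /= => /andP[at_ tb] /andP[as_ sb].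
  by rewrite le_min as_ at_ ge_max sb tb le_max ge_min lexx.
have {}hbound : `|h r - h p - \sum_i g i s * (x i r - x i p)|
        <= e / 2 * \sum_i `|x i r - x i p|.
  (* When [t < s], swapping the endpoints only flips the sign inside the norm: the coefficients stay
     evaluated at [s]. *)
  rewrite /p /r; case: (leP s t) => // ts.
  have -> : h s - h t - \sum_i g i s * (x i s - x i t) =
      - (h t - h s - \sum_i g i s * (x i t - x i s)).
    rewrite !opprB addrC -sumrN; congr (_ + _).
    by apply: eq_bigr => i _; ring.
  rewrite normrN (le_trans hbound)// ler_pM2l//.
  by apply: ler_sum => i _; rewrite distrC.
have vpr i : mu.-integrable `[p, r] (fun t => (v i t)%:E).
  exact: integrable_sub_itv (vint i).
have gvpr i : mu.-integrable `[p, r] (fun t => (g i t * v i t)%:E).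
  exact: integrable_sub_itv (gvint i).
have npr i : mu.-integrable `[p, r] (fun t => `|v i t|%:E).
  exact: integrable_normr.
have gsvpr i : mu.-integrable `[p, r] (fun t => (g i s * v i t)%:E).
  exact: integrable_scaler.
have xrp i : x i r - x i p = \int[mu]_(z in `[p, r]) v i z.
  exact: Rintegral_increment (vint i) (xE i) ap pr rb.
rewrite !Rintegral_sum//.
(* First-order remainder plus the error of freezing [g i] at [s]. *)
have -> : h r - h p - \sum_i \int[mu]_(z in `[p, r]) (g i z * v i z) =
  (h r - h p - \sum_i g i s * (x i r - x i p)) +
  \sum_i \int[mu]_(z in `[p, r]) (g i s * v i z - g i z * v i z).
  rewrite -[LHS](subrKA (\sum_i g i s * (x i r - x i p))); congr (_ + _).
  rewrite -sumrB; apply: eq_bigr => i _.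
  rewrite RintegralB//; [|exact: gsvpr|exact: gvpr].
  by rewrite RintegralZl ?xrp//; exact: vpr.
rewrite (le_trans (ler_normD _ _))// [leRHS](_ : _ =
  e / 2 * (\sum_i \int[mu]_(z in `[p, r]) `|v i z|) +
  e / 2 * (\sum_i \int[mu]_(z in `[p, r]) `|v i z|)); last by field.
apply: lerD.
  rewrite (le_trans hbound)// ler_pM2l//; apply: ler_sum => i _.
  by rewrite xrp; apply: le_normr_Rintegral => //; exact: vpr.
rewrite (le_trans (ler_norm_sum _ _ _))// mulr_sumr; apply: ler_sum => i _.
have dint : mu.-integrable `[p, r] (fun z => (g i s * v i z - g i z * v i z)%:E).
  exact: integrable_subr.
rewrite (le_trans (le_normr_Rintegral _ dint))// -RintegralZl//; last exact: npr.
apply: le_Rintegral => //.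
- exact: integrable_normr.
- by apply: integrable_scaler => //; exact: integrable_normr.
move=> z zpr; rewrite -mulrBl normrM ler_wpM2r// gbound//.
by move: zpr; rewrite /= !in_itv /=; lra.
Unshelve. all: by end_near. Qed.

(** * Densities as derivatives almost everywhere *)

#[local] Instance lebesgue_ae_filter {R : realType} :
  Filter (nbhs (almost_everywhere (@lebesgue_measure R))).
Proof. exact: ae_filter_ringOfSetsType. Qed.

Lemma ae_neq {R : realType} (c : R) : {ae mu, forall t : R, t != c}.
Proof.
exists [set c]; split => //; first exact: lebesgue_measure_set1.
by move=> t /= /negP; rewrite negbK => /eqP.
Qed.

(** Lebesgue's differentiation theorem for [v] extended by zero. The endpoints are discarded as a
    null set: a two-sided derivative there would depend on values of [x] outside [[a, b]]. *)
Lemma ae_is_derive_Rintegral {R : realType} (a b : R) (x v : R -> R) :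
  mu.-integrable `[a, b] (fun t => (v t)%:E) ->
  (forall t, t \in `[a, b] ->
    x t = x a + \int[mu]_(z in `[a, t]) v z) ->
  {ae mu, forall t : R, t \in `[a, b] -> is_derive t 1 x (v t)}.
Proof.
move=> vint xE; pose f := v \_ `[a, b].
have fint : mu.-integrable setT (EFin \o f).
  by rewrite -restrict_EFin; apply/integrable_restrict => //=; rewrite setTI.
have fint_y (y : R) : mu.-integrable [set` Interval (BLeft a) (BRight y)] (EFin \o f).
  by apply: integrableS fint.
have floc : locally_integrable [set: R] f by exact: integrable_locally.
have ftc := FTC1 fint_y floc.
have nea := ae_neq a; have neb := ae_neq b.
apply: filterS3 ftc nea neb => t ftct ta tb; rewrite in_itv /= => /andP[at_ tleb].
have {at_ ta}at_ : a < t by rewrite lt_neqAle eq_sym ta.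
have {tleb tb}tb : t < b by rewrite lt_neqAle tb.
have [|fder fE] := ftct; first by rewrite /= lte_fin.
have vE : f t = v t by rewrite /f patchE mem_set//= in_itv /= !ltW.
(* At an interior point, [x] agrees nearby with the indefinite integral of the extension [f]. *)
apply: (@near_eq_is_derive _ _ _ (fun y => x a + \int[mu]_(z in `[a, y]) f z)).
  near=> y.
  have /andP[ay yb] : a < y < b.
    apply/andP; split; near: y; [exact: lt_nbhsr|exact: lt_nbhsl].
  rewrite (xE y) ?in_itv /= ?ltW//; congr (_ + _).
  apply: eq_Rintegral => z /set_mem; rewrite /= in_itv /= => /andP[az zy].
  by rewrite /f patchE mem_set//= in_itv /= az (le_trans zy)// ltW.
rewrite -vE -fE derive1E -[X in is_derive _ _ _ X]add0r.
by apply: is_deriveD; exact: derivableP.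
Unshelve. all: by end_near. Qed.

Lemma within_continuous_Rintegral {R : realType} (a b : R) (x v : R -> R) :
  a <= b -> mu.-integrable `[a, b] (fun t => (v t)%:E) ->
  (forall t, t \in `[a, b] ->
    x t = x a + \int[mu]_(z in `[a, t]) v z) ->
  {within `[a, b], continuous x}.
Proof.
move=> ab vint xE.
have Ic : {within `[a, b], continuous
    (fun t => x a + \int[mu]_(z in `[a, t]) v z)}.
  have := parameterized_integral_continuous ab vint.
  by move=> Ic t; apply: cvgD; [exact: cvg_cst|exact: Ic].
apply: subspace_eq_continuous Ic => t /set_mem tab.
exact/esym/xE.
Qed.

Lemma is_derive_coord {R : realType} m n (M : R -> 'M[R]_(m, n)) (t : R)
    (D : 'M[R]_(m, n)) i j :
  is_derive t 1 M D -> is_derive t 1 (fun s => M s i j) (D i j).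
Proof.
move=> [Md <-]; rewrite derive_mx// mxE; apply/derivableP.
by move/derivable_mxP : Md; apply.
Qed.

Lemma is_derive_uniq {R : realType} (f : R -> R) (t df dg : R) :
  is_derive t 1 f df -> is_derive t 1 f dg -> df = dg.
Proof. by move=> [_ <-] [_ <-]. Qed.

Lemma ae_eq_Rintegral {R : realType} (D : set R) (f g : R -> R) : measurable D ->
  measurable_fun D f -> measurable_fun D g ->
  {ae mu, forall t : R, D t -> f t = g t} ->
  \int[mu]_(t in D) f t = \int[mu]_(t in D) g t.
Proof.
move=> mD mf mg fg; congr fine; apply: ae_eq_integral => //.
- exact/measurable_EFinP.
- exact/measurable_EFinP.
by apply: filterS fg => t fgt Dt; congr EFin; exact: fgt.
Qed.

Lemma ae_eq_integrable {R : realType} (D : set R) (f g : R -> R) :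
  measurable D -> measurable_fun D g ->
  mu.-integrable D (fun t => (f t)%:E) ->
  {ae mu, forall t : R, D t -> f t = g t} ->
  mu.-integrable D (fun t => (g t)%:E).
Proof.
move=> mD mg /integrableP[mf fint] fg; apply/integrableP; split.
  exact/measurable_EFinP.
suff <- : (\int[mu]_(t in D) `|(f t)%:E| = \int[mu]_(t in D) `|(g t)%:E|)%E by [].
apply: ae_eq_integral => //.
- exact: measurableT_comp.
- by apply: measurableT_comp => //; exact/measurable_EFinP.
by apply: filterS fg => t fgt Dt; rewrite fgt.
Qed.

(** * Gradients and first-order estimates along a path *)

Lemma dotE {R : realType} n (u v : 'cV[R]_n) :
  dot u v = \sum_i u i 0 * v i 0.
Proof. by rewrite /dot mxE; apply: eq_bigr => i _; rewrite mxE. Qed.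

Lemma dotBE {R : realType} n (u v w : 'cV[R]_n) :
  dot u (v - w) = \sum_i u i 0 * (v i 0 - w i 0).
Proof. by rewrite dotE; apply: eq_bigr => i _; rewrite !mxE. Qed.

Lemma cvg_mx {R : realType} (T : Type) (F : set_system T) m n
    (f : T -> 'M[R]_(m, n)) (M : 'M[R]_(m, n)) : Filter F ->
  (forall i j, f t i j @[t --> F] --> M i j) -> f t @[t --> F] --> M.
Proof.
move=> FF fM A [P PM sPA].
(* A neighbourhood of a matrix contains a product of neighbourhoods [P i j] of its finitely many
   entries. *)
have sPA' : [set t | forall i j, P i j (f t i j)] `<=` f @^-1` A.
  by move=> t; exact: sPA.
apply: (filterS sPA').
apply: (@filter_forall T 'I_m (fun i t => forall j, P i j (f t i j)) F) => i.
apply: (@filter_forall T 'I_n (fun j t => P i j (f t i j)) F) => j.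
exact: fM (PM i j).
Qed.

Lemma mx_norm_le_sum {R : realType} n (u : 'cV[R]_n) :
  `|u| <= \sum_i `|u i 0|.
Proof.
rewrite [leLHS]/Num.norm /= mx_normrE; apply: bigmax_le => [|[i j] _ /=].
  by apply: sumr_ge0.
by rewrite (ord1 j) (bigD1 i)//= lerDl; apply: sumr_ge0.
Qed.

(** The differential is linear, and [y] is a combination of the coordinate directions [dir1 i] and
    [dir2 j], on which it gives the partial derivatives. *)
Lemma diff_grad {R : realType} n1 n2 (H : 'cV[R]_n1 * 'cV[R]_n2 -> R) x y :
  differentiable H x ->
  'd H x y = dot (grad1 H x) y.1 + dot (grad2 H x) y.2.
Proof.
move=> dH.
have {1}-> : y = \sum_i y.1 i 0 *: dir1 R n2 i + \sum_j y.2 j 0 *: dir2 R n1 j.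
  case: y => u v /=.
  have colE n (w : 'cV[R]_n) : w = \sum_i w i 0 *: delta_mx i 0.
    rewrite [LHS]matrix_sum_delta; apply: eq_bigr => i _.
    by rewrite big_ord1.
  (* The embeddings of the two factors are additive, hence commute with finite sums. *)
  have inl_sum := big_morph (fun w : 'cV[R]_n1 => (w, 0 : 'cV[R]_n2))
    (id1 := 0) (op1 := +%R).
  have inr_sum := big_morph (fun w : 'cV[R]_n2 => (0 : 'cV[R]_n1, w))
    (id1 := 0) (op1 := +%R).
  transitivity ((u, 0) + (0, v) : 'cV[R]_n1 * 'cV[R]_n2).
    by rewrite /GRing.add /= /add_pair /= addr0 add0r.
  rewrite [in LHS](colE _ u) [in LHS](colE _ v) inl_sum//; last first.
    by move=> p q; rewrite /GRing.add /= /add_pair /= addr0.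
  rewrite inr_sum//; last first.
    by move=> p q; rewrite /GRing.add /= /add_pair /= addr0.
  congr (_ + _); apply: eq_bigr => i _.
    by rewrite /dir1 /GRing.scale /= /scale_pair /= scaler0.
  by rewrite /dir2 /GRing.scale /= /scale_pair /= scaler0.
rewrite linearD !linear_sum !dotE; congr (_ + _); apply: eq_bigr => i _.
  by rewrite linearZ /= -deriveE// mxE mulrC.
by rewrite linearZ /= -deriveE// mxE mulrC.
Qed.

Lemma path_cvg {R : realType} n1 n2 (a b : R)
    (x1 : R -> 'cV[R]_n1) (x2 : R -> 'cV[R]_n2) s :
  (forall i, {within `[a, b], continuous (fun t => x1 t i 0)}) ->
  (forall j, {within `[a, b], continuous (fun t => x2 t j 0)}) ->
  s \in `[a, b] ->
  (x1 t, x2 t) @[t --> within `[a, b] (nbhs s)] --> (x1 s, x2 s).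
Proof.
move=> x1c x2c sab; 
refine (@cvg_pair R _ _ (within `[a, b] (nbhs s)) (nbhs (x1 s)) (nbhs (x2 s))
  _ _ _ x1 x2 _ _).
  refine (@cvg_mx R R (within `[a, b] (nbhs s)) n1 1 x1 (x1 s) _ _) => i j.
  rewrite (ord1 j).
  exact: ((subspace_continuousP _ (fun t => x1 t i 0)).1 (x1c i) s sab).
refine (@cvg_mx R R (within `[a, b] (nbhs s)) n2 1 x2 (x2 s) _ _) => i j.
rewrite (ord1 j).
exact: ((subspace_continuousP _ (fun t => x2 t i 0)).1 (x2c i) s sab).
Qed.

Lemma path_comp_continuous {R : realType} n1 n2 (a b : R)
    (x1 : R -> 'cV[R]_n1) (x2 : R -> 'cV[R]_n2)
    (T : topologicalType)
    (f : 'cV[R]_n1 * 'cV[R]_n2 -> T) :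
  (forall i, {within `[a, b], continuous (fun t => x1 t i 0)}) ->
  (forall j, {within `[a, b], continuous (fun t => x2 t j 0)}) ->
  (forall s, s \in `[a, b] -> {for (x1 s, x2 s), continuous f}) ->
  {within `[a, b], continuous (fun t => f (x1 t, x2 t))}.
Proof.
move=> x1c x2c fc; apply/subspace_continuousP => s sab.
apply: (@cvg_comp _ _ _ (fun t => (x1 t, x2 t)) f); first exact: path_cvg sab.
exact: fc.
Qed.

(** Differentiability of [H] at the single point [(x1 s, x2 s)], pulled back along the continuous
    path. It supplies the local hypothesis of [Rintegral_chain_rule]. *)
Lemma path_differentiable_bound {R : realType} n1 n2 (a b : R)
    (x1 : R -> 'cV[R]_n1) (x2 : R -> 'cV[R]_n2)
    (H : 'cV[R]_n1 * 'cV[R]_n2 -> R) s e :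
  (forall i, {within `[a, b], continuous (fun t => x1 t i 0)}) ->
  (forall j, {within `[a, b], continuous (fun t => x2 t j 0)}) ->
  s \in `[a, b] -> differentiable H (x1 s, x2 s) -> 0 < e ->
  \forall t \near s, t \in `[a, b] ->
    `|H (x1 t, x2 t) - H (x1 s, x2 s)
      - (dot (grad1 H (x1 s, x2 s)) (x1 t - x1 s)
         + dot (grad2 H (x1 s, x2 s)) (x2 t - x2 s))|
    <= e * (\sum_i `|x1 t i 0 - x1 s i 0| + \sum_j `|x2 t j 0 - x2 s j 0|).
Proof.
move=> x1c x2c sab dH e0.
have /eqaddoP/(_ e e0) := diff_locally dH.
move=> Ho.
have : (x1 t, x2 t) - (x1 s, x2 s) @[t --> within `[a, b] (nbhs s)] -->
    (0 : 'cV[R]_n1 * 'cV[R]_n2).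
  rewrite -(subrr (x1 s, x2 s)); apply: cvgB; [exact: path_cvg|exact: cvg_cst].
move=> /(_ _ Ho) Hs; apply: (filterS _ (Hs : nbhs s _)) => t Ht tab.
have := Ht tab.
rewrite /= !fctE /= subrK diff_grad//= opprD addrA => Hb.
apply: le_trans (Hb) _; rewrite ler_pM2l// .
(* The product norm is the maximum of two sup norms, each at most the sum of the absolute values of
   its entries. *)
rewrite [leLHS]/Num.norm /= ge_max; apply/andP; split.
  apply: le_trans (mx_norm_le_sum (x1 t - x1 s)) _.
  rewrite (_ : \sum_i _ = \sum_i `|x1 t i 0 - x1 s i 0|); last first.
    by apply: eq_bigr => i _; rewrite !mxE.
  by rewrite lerDl; apply: sumr_ge0.
apply: le_trans (mx_norm_le_sum (x2 t - x2 s)) _.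
rewrite (_ : \sum_i _ = \sum_i `|x2 t i 0 - x2 s i 0|); last first.
  by apply: eq_bigr => i _; rewrite !mxE.
by rewrite lerDr; apply: sumr_ge0.
Qed.

(* [abs_continuous a b x] is [exists v, ac_density a b x v]. *)
Definition ac_density {R : realType} n (a b : R) (x v : R -> 'cV[R]_n) :=
  forall i : 'I_n, mu.-integrable `[a, b] (fun s => (v s i 0)%:E) /\
    forall t, t \in `[a, b] ->
      x t i 0 = x a i 0 + \int[mu]_(s in `[a, t]) v s i 0.

Lemma Rintegral_chain_rule_grad {R : realType} n1 n2 (a b : R)
    (x1 v1 : R -> 'cV[R]_n1) (x2 v2 : R -> 'cV[R]_n2)
    (H : 'cV[R]_n1 * 'cV[R]_n2 -> R) : a <= b ->
  ac_density a b x1 v1 -> ac_density a b x2 v2 ->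
  (forall t, t \in `[a, b] -> differentiable H (x1 t, x2 t)) ->
  (forall i, {within `[a, b],
    continuous (fun t => grad1 H (x1 t, x2 t) i 0)}) ->
  (forall j, {within `[a, b],
    continuous (fun t => grad2 H (x1 t, x2 t) j 0)}) ->
  H (x1 b, x2 b) - H (x1 a, x2 a) =
  \int[mu]_(t in `[a, b]) (dot (grad1 H (x1 t, x2 t)) (v1 t)
    + dot (grad2 H (x1 t, x2 t)) (v2 t)).
Proof.
move=> ab /all_and2[v1int x1E] /all_and2[v2int x2E] dH g1c g2c.
(* The coordinates of both blocks form one family indexed by ['I_n1 + 'I_n2]. *)
pose sel (f1 : R -> 'cV[R]_n1) (f2 : R -> 'cV[R]_n2) (k : 'I_n1 + 'I_n2) t :=
  match k with inl i => f1 t i 0 | inr j => f2 t j 0 end.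
have x1c i := within_continuous_Rintegral ab (v1int i) (x1E i).
have x2c j := within_continuous_Rintegral ab (v2int j) (x2E j).
rewrite (@Rintegral_chain_rule R _ a b (sel x1 x2) (sel v1 v2)
  (sel (fun t => grad1 H (x1 t, x2 t)) (fun t => grad2 H (x1 t, x2 t)))
  (fun t => H (x1 t, x2 t)))//.
- by apply: eq_Rintegral => t _; rewrite big_sumType !dotE.
- by case.
- by case.
- by case.
move=> e e0 s sab.
have := path_differentiable_bound x1c x2c sab (dH s sab) e0.
by apply: filterS => t Ht tab; move: (Ht tab); rewrite !big_sumType !dotBE.
Qed.

(** * Smooth maps and their partial derivatives *)

Lemma smooth_on_continuous {R : realType} (V W : normedModType R) (X : set V)
    (f : V -> W) x : smooth_on X f -> X x -> {for x, continuous f}.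
Proof.
by move=> fsm Xx; apply: differentiable_continuous; exact: (fsm [::] x Xx).
Qed.

(** Appending [v] at the end of the list of directions makes ['D_v] the innermost derivative. *)
Lemma smooth_on_derive {R : realType} (V W : normedModType R) (X : set V)
    (f : V -> W) v : smooth_on X f -> smooth_on X ('D_v f).
Proof.
by move=> fsm vs x Xx; have := fsm (rcons vs v) x Xx; rewrite foldr_rcons.
Qed.

Lemma smooth_on_grad1_continuous {R : realType} n1 n2
    (H : 'cV[R]_n1 * 'cV[R]_n2 -> R) X x i : smooth_on X H -> X x ->
  {for x, continuous (fun y => grad1 H y i 0)}.
Proof.
move=> Hsm Xx.
rewrite (_ : (fun y => _) = 'D_(dir1 R n2 i) H); last first.
  by apply/funext => y; rewrite mxE.
exact: smooth_on_continuous (smooth_on_derive _ Hsm) Xx.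
Qed.

Lemma smooth_on_grad2_continuous {R : realType} n1 n2
    (H : 'cV[R]_n1 * 'cV[R]_n2 -> R) X x j : smooth_on X H -> X x ->
  {for x, continuous (fun y => grad2 H y j 0)}.
Proof.
move=> Hsm Xx.
rewrite (_ : (fun y => _) = 'D_(dir2 R n1 j) H); last first.
  by apply/funext => y; rewrite mxE.
exact: smooth_on_continuous (smooth_on_derive _ Hsm) Xx.
Qed.

(** * Dot products and their integrals along a path *)

Lemma dotDr {R : realType} n (u v w : 'cV[R]_n) :
  dot u (v + w) = dot u v + dot u w.
Proof. by rewrite /dot mulmxDr mxE. Qed.

Lemma dotNr {R : realType} n (u v : 'cV[R]_n) : dot u (- v) = - dot u v.
Proof. by rewrite /dot mulmxN mxE. Qed.

Lemma dotNl {R : realType} n (u v : 'cV[R]_n) : dot (- u) v = - dot u v.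
Proof. by rewrite /dot linearN mulNmx mxE. Qed.

Lemma dotDl {R : realType} n (u v w : 'cV[R]_n) :
  dot (u + v) w = dot u w + dot v w.
Proof. by rewrite /dot linearD mulmxDl mxE. Qed.

Lemma dot_mulmxr {R : realType} m n (A : 'M[R]_(m, n)) u v :
  dot u (A *m v) = dot (A^T *m u) v.
Proof. by rewrite /dot trmx_mul trmxK mulmxA. Qed.

Lemma dotC {R : realType} n (u v : 'cV[R]_n) : dot u v = dot v u.
Proof. by rewrite !dotE; apply: eq_bigr => i _; rewrite mulrC. Qed.

Lemma dot_skew {R : realType} n (J : 'M[R]_n) (e : 'cV[R]_n) :
  J = - J^T -> dot e (J *m e) = 0.
Proof.
move=> skew; have : dot e (J *m e) = - dot e (J *m e).
  by rewrite {1}skew mulNmx dotNr dotC -dot_mulmxr.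
lra.
Qed.

Lemma Rintegrable_measurable {R : realType} (D : set R) (f : R -> R) :
  mu.-integrable D (fun t => (f t)%:E) -> measurable_fun D f.
Proof. by case/integrableP => mf _; exact/measurable_EFinP. Qed.

Lemma integrable_dot {R : realType} n (a b : R) (g v : R -> 'cV[R]_n) :
  (forall i, {within `[a, b], continuous (fun t => g t i 0)}) ->
  (forall i, mu.-integrable `[a, b] (fun t => (v t i 0)%:E)) ->
  mu.-integrable `[a, b] (fun t => (dot (g t) (v t))%:E).
Proof.
move=> gc vint.
rewrite (_ : (fun t => _) = (fun t => (\sum_i g t i 0 * v t i 0)%:E)).
  by apply: integrable_sumr => // i; exact: integrable_continuousM.
by apply/funext => t; rewrite dotE.
Qed.

(** For the isothermals: the constant effort leaves the integral, and what remains is the increment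
    of [x]. *)
Lemma Rintegral_dot_cst {R : realType} n (a b p r : R)
    (x v : R -> 'cV[R]_n) (c : 'cV[R]_n) (g : R -> 'cV[R]_n) :
  ac_density a b x v -> a <= p -> p <= r -> r <= b ->
  (forall t, t \in `[p, r] -> g t = c) ->
  \int[mu]_(t in `[p, r]) dot (g t) (v t) = dot c (x r - x p).
Proof.
move=> /all_and2[vint xE] ap pr rb gE.
transitivity (\int[mu]_(t in `[p, r]) \sum_i c i 0 * v t i 0).
  by apply: eq_Rintegral => t /set_mem /= tpr; rewrite gE// dotE.
have vpr i := integrable_sub_itv ap rb (vint i).
rewrite Rintegral_sum// => [|i]; last exact: integrable_scaler.
rewrite dotBE; apply: eq_bigr => i _.
rewrite RintegralZl//; last exact: vpr.
by rewrite (Rintegral_increment (vint i) (xE i)).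
Qed.

(** For the adiabatics: almost everywhere the density [v] is the derivative of a constant, so it
    vanishes there. *)
Lemma Rintegral_dot_stationary {R : realType} n (a b p r : R)
    (x v : R -> 'cV[R]_n) (g : R -> 'cV[R]_n) :
  ac_density a b x v -> a <= p -> p <= r -> r <= b ->
  (forall t, t \in `[p, r] -> x t = x p) ->
  mu.-integrable `[p, r] (fun t => (dot (g t) (v t))%:E) ->
  \int[mu]_(t in `[p, r]) dot (g t) (v t) = 0.
Proof.
move=> /all_and2[vint xE] ap pr rb xcst gvint.
have v0 i : {ae mu, forall t : R, t \in `[p, r] -> v t i 0 = 0}.
  (* Differentiation is applied to the constant function [x p i 0], of which [v] is also a density
     on [[p, r]]. *)
  have : {ae mu, forall t : R, t \in `[p, r] ->
      is_derive t 1 (cst (x p i 0)) (v t i 0)}.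
    apply: ae_is_derive_Rintegral; first exact: integrable_sub_itv (vint i).
    move=> t tpr /=; have := tpr; rewrite in_itv /= => /andP[pt tr].
    rewrite -(Rintegral_increment (vint i) (xE i) ap pt (le_trans tr rb)).
    by rewrite (xcst t)// subrr addr0.
  apply: filterS => t H tpr.
  exact: is_derive_uniq (H tpr) (is_derive_cst _ _ _).
(* Finitely many null sets have a null union, so one exceptional set serves all [i]. *)
have {}v0 : {ae mu, forall t : R, forall i, t \in `[p, r] -> v t i 0 = 0}.
  refine (@filter_forall _ 'I_n (fun i t => t \in `[p, r] -> v t i 0 = 0)
    (almost_everywhere (@lebesgue_measure R)) _ v0).
transitivity (\int[mu]_(t in `[p, r]) (0 : R)); last first.
  by rewrite Rintegral_cst// mul0r.
apply: ae_eq_Rintegral => //.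
  exact: Rintegrable_measurable gvint.
apply: filterS v0 => t v0 tpr.
by rewrite dotE big1// => i _; rewrite v0// mulr0.
Qed.

Lemma matrix_path_continuous {R : realType} n1 n2 m n (a b : R)
    (x1 : R -> 'cV[R]_n1) (x2 : R -> 'cV[R]_n2)
    (X : set ('cV[R]_n1 * 'cV[R]_n2))
    (M : 'cV[R]_n1 * 'cV[R]_n2 -> 'M[R]_(m, n)) i j :
  (forall i, {within `[a, b], continuous (fun t => x1 t i 0)}) ->
  (forall j, {within `[a, b], continuous (fun t => x2 t j 0)}) ->
  (forall t, t \in `[a, b] -> X (x1 t, x2 t)) -> smooth_on X M ->
  {within `[a, b], continuous (fun t => M (x1 t, x2 t) i j)}.
Proof.
move=> x1c x2c Xx Msm.
apply: (path_comp_continuous x1c x2c (f := fun y => M y i j)) => s sab.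
apply: (@continuous_comp _ _ _ M (fun A : 'M[R]_(m, n) => A i j)).
  exact: smooth_on_continuous Msm (Xx s sab).
exact: coord_continuous.
Qed.

(** * The energy balance along a solution *)

Section energy_balance.
Context {R : realType} (n1 n2 m2 : nat) (S : ph_system R n1 n2 m2).
Context (tau : R) (x1 v1 : R -> 'cV[R]_n1) (x2 v2 : R -> 'cV[R]_n2).
Context (u1 y1 : R -> 'cV[R]_n1) (u2 y2 : R -> 'cV[R]_m2).
Hypothesis tau_ge0 : 0 <= tau.
Hypothesis sol : ph_solution S tau x1 x2 u1 y1 u2 y2.
Hypothesis v1E : ac_density 0 tau x1 v1.
Hypothesis v2E : ac_density 0 tau x2 v2.

Let e1 t := ph_e1 S (x1 t, x2 t).
Let e2 t := ph_e2 S (x1 t, x2 t).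

Let x1c i : {within `[0, tau], continuous (fun t => x1 t i 0)}.
Proof.
exact: within_continuous_Rintegral tau_ge0 (v1E i).1 (v1E i).2.
Qed.

Let x2c i : {within `[0, tau], continuous (fun t => x2 t i 0)}.
Proof.
exact: within_continuous_Rintegral tau_ge0 (v2E i).1 (v2E i).2.
Qed.

Lemma ph_e1_continuous i : {within `[0, tau], continuous (fun t => e1 t i 0)}.
Proof.
apply: (path_comp_continuous x1c x2c (f := fun y => grad1 (ph_H S) y i 0)).
move=> s /(sol_X sol) Xs.
exact: smooth_on_grad1_continuous (@ph_H_smooth _ _ _ _ S) Xs.
Qed.

Lemma ph_e2_continuous i : {within `[0, tau], continuous (fun t => e2 t i 0)}.
Proof.
apply: (path_comp_continuous x1c x2c (f := fun y => grad2 (ph_H S) y i 0)).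
move=> s /(sol_X sol) Xs.
exact: smooth_on_grad2_continuous (@ph_H_smooth _ _ _ _ S) Xs.
Qed.

Lemma integrable_dot_e1 :
  mu.-integrable `[0, tau] (fun t => (dot (e1 t) (v1 t))%:E).
Proof.
by apply: integrable_dot => i; [exact: ph_e1_continuous|exact: (v1E i).1].
Qed.

Lemma integrable_dot_e2 :
  mu.-integrable `[0, tau] (fun t => (dot (e2 t) (v2 t))%:E).
Proof.
by apply: integrable_dot => i; [exact: ph_e2_continuous|exact: (v2E i).1].
Qed.

Definition dissipation2 t := dot (e2 t) (ph_R2 S (x1 t, x2 t) *m e2 t).

Lemma integrable_dissipation2 :
  mu.-integrable `[0, tau] (fun t => (dissipation2 t)%:E).
Proof.
apply: integrable_dot => i; first exact: ph_e2_continuous.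
rewrite (_ : (fun t => _) = (fun t => (\sum_j ph_R2 S (x1 t, x2 t) i j
    * e2 t j 0)%:E)); last by apply/funext => t; rewrite mxE.
apply: integrable_sumr => // j; apply: integrable_continuousM.
  exact: matrix_path_continuous x1c x2c (sol_X sol) (@ph_R2_smooth _ _ _ _ S).
apply: continuous_compact_integrable; first exact: segment_compact.
exact: ph_e2_continuous.
Qed.

(** As [u2] is only measurable, the port power is shown here to be measurable; its integrability
    comes later, through the differential equation. *)
Lemma measurable_port2 :
  measurable_fun `[0, tau] (fun t => dot (y2 t) (u2 t)).
Proof.
apply: (eq_measurable_fun (fun t => \sum_k
    (\sum_i ph_G2 S (x1 t, x2 t) i k * e2 t i 0) * u2 t k 0)).
  move=> t /set_mem /= tin; rewrite dotE; apply: eq_bigr => k _.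
  rewrite (sol_y2 sol)// mxE; congr (_ * _).
  by apply: eq_bigr => i _; congr (_ * _); rewrite [RHS]mxE.
apply: measurable_sum => k; apply: measurable_funM; last exact: (sol_u2 sol).
apply: measurable_sum => i; apply: measurable_funM.
  apply: within_continuous_measurable.
  exact: matrix_path_continuous x1c x2c (sol_X sol) (@ph_G2_smooth _ _ _ _ S).
by apply: within_continuous_measurable; exact: ph_e2_continuous.
Qed.

(** Almost everywhere [v2] is the right-hand side of the second equation. There [J2] contributes
    nothing by skew-symmetry, the [R2] term cancels [dissipation2], and transposing [G2] turns [e2]
    into [y2]. *)
Lemma ae_port2_power : {ae mu, forall t : R, t \in `[0, tau] ->
  dot (e2 t) (v2 t) + dissipation2 t = dot (y2 t) (u2 t)}.
Proof.
have v2D : {ae mu, forall t : R, forall i, t \in `[0, tau] ->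
    is_derive t 1 (fun s => x2 s i 0) (v2 t i 0)}.
  refine (@filter_forall _ 'I_n2 (fun i t => t \in `[0, tau] ->
      is_derive t 1 (fun s => x2 s i 0) (v2 t i 0))
    (almost_everywhere (@lebesgue_measure R)) _ _) => i.
  exact: ae_is_derive_Rintegral (v2E i).1 (v2E i).2.
apply: filterS2 (sol_eq2 sol) v2D => t ode v2D tin.
have {v2D} -> : v2 t = ph_J2 S (x1 t, x2 t) *m e2 t
    - ph_R2 S (x1 t, x2 t) *m e2 t + ph_G2 S (x1 t, x2 t) *m u2 t.
  apply/matrixP => i j; rewrite (ord1 j).
  exact: is_derive_uniq (v2D i tin) (is_derive_coord i 0 (ode tin)).
rewrite !dotDr dotNr dot_skew; last by apply: ph_J2_skew; exact: (sol_X sol).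
by rewrite (sol_y2 sol)// -dot_mulmxr /dissipation2; lra.
Qed.

(** This makes the integral in [delivered2] meaningful: [Rintegral] sends an infinite integral to
    0. *)
Lemma integrable_port2 :
  mu.-integrable `[0, tau] (fun t => (dot (y2 t) (u2 t))%:E).
Proof.
apply: (ae_eq_integrable _ measurable_port2 _ ae_port2_power) => //.
by apply: integrable_addr => //;
  [exact: integrable_dot_e2|exact: integrable_dissipation2].
Qed.

(** The chain rule for [H] combined with the integral of [ae_port2_power]. The port-1 term stays in
    the form [e1 . v1], which the phases of a Carnot cycle evaluate directly. *)
Lemma ph_energy_balance :
  delivered2 tau u2 y2 = \int[mu]_(t in `[0, tau]) dot (e1 t) (v1 t)
    - \int[mu]_(t in `[0, tau]) dissipation2 t
    - (ph_H S (x1 tau, x2 tau) - ph_H S (x1 0, x2 0)).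
Proof.
rewrite (Rintegral_chain_rule_grad tau_ge0 v1E v2E); last 3 first.
- by move=> t /(sol_X sol) Xt; exact: (ph_H_smooth [::] Xt).
- exact: ph_e1_continuous.
- exact: ph_e2_continuous.
rewrite RintegralD//; [|exact: integrable_dot_e1|exact: integrable_dot_e2].
rewrite /delivered2.
rewrite -(ae_eq_Rintegral _ _ measurable_port2 ae_port2_power)//; last first.
  apply: Rintegrable_measurable; apply: integrable_addr => //.
    exact: integrable_dot_e2.
  exact: integrable_dissipation2.
rewrite RintegralD//; [|exact: integrable_dot_e2|exact: integrable_dissipation2].
rewrite -/(e1 _) -/(e2 _); lra.
Qed.

Lemma dissipation2_ge0 t : t \in `[0, tau] -> 0 <= dissipation2 t.
Proof. by move=> /(sol_X sol) Xt; exact: ph_R2_ge0. Qed.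

End energy_balance.

(** * Carnot cycles *)

Lemma carnot_isotherm_energy {R : realType} n1 n2 m2 (S : ph_system R n1 n2 m2)
    (tau1 tau2 tau3 tau : R) (e1h e1c : 'cV[R]_n1)
    (x1 v1 : R -> 'cV[R]_n1) (x2 : R -> 'cV[R]_n2)
    (u1 y1 : R -> 'cV[R]_n1) (u2 y2 : R -> 'cV[R]_m2) :
  carnot_cycle S tau1 tau2 tau3 tau e1h e1c x1 x2 u1 y1 u2 y2 ->
  ac_density 0 tau x1 v1 ->
  mu.-integrable `[0, tau] (fun t => (dot (ph_e1 S (x1 t, x2 t)) (v1 t))%:E) ->
  \int[mu]_(t in `[0, tau]) dot (ph_e1 S (x1 t, x2 t)) (v1 t) =
  dot e1h (x1 tau1 - x1 0) + dot e1c (x1 tau3 - x1 tau2).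
Proof.
move=> cycle v1E wint; have [tau01 tau12 tau23 tau3t] := cc_times cycle.
have tau02 := le_trans tau01 tau12; have tau03 := le_trans tau02 tau23.
have tau2t := le_trans tau23 tau3t; have tau1t := le_trans tau12 tau2t.
have wsub p r : 0 <= p -> r <= tau ->
    mu.-integrable `[p, r]
      (fun t => (dot (ph_e1 S (x1 t, x2 t)) (v1 t))%:E).
  by move=> p0 rt; exact: integrable_sub_itv wint.
(* The cycle is cut into its four phases, starting from the last switching time. *)
rewrite (@Rintegral_cc_split _ 0 tau3)// (@Rintegral_cc_split _ 0 tau2 tau3)//;
  last exact: wsub.
rewrite (@Rintegral_cc_split _ 0 tau1 tau2)//; last exact: wsub.
rewrite (Rintegral_dot_cst v1E _ _ _ (cc_hot cycle))//.
rewrite (Rintegral_dot_cst v1E _ _ _ (cc_cold cycle))//.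
rewrite (Rintegral_dot_stationary v1E _ _ _ (cc_adiabatic1 cycle))//;
  last exact: wsub.
rewrite (Rintegral_dot_stationary v1E _ _ _ (cc_adiabatic2 cycle))//;
  last exact: wsub.
by rewrite !addr0.
Qed.

Theorem mainTheorem2 (R : realType) (n1 n2 m2 : nat)
    (S : ph_system R n1 n2 m2) (tau1 tau2 tau3 tau : R)
    (e1h e1c : 'cV[R]_n1) (x1 : R -> 'cV[R]_n1) (x2 : R -> 'cV[R]_n2)
    (u1 y1 : R -> 'cV[R]_n1) (u2 y2 : R -> 'cV[R]_m2)
    (cycle : carnot_cycle S tau1 tau2 tau3 tau e1h e1c x1 x2 u1 y1 u2 y2) :
  let dxh := x1 tau1 - x1 0 in
  let dxc := x1 tau3 - x1 tau2 in
  let R1_zero := forall x, ph_X S x -> ph_R1 S x = 0 in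
  let R2_zero := forall x, ph_X S x -> ph_R2 S x = 0 in
  [/\ dxh + dxc = 0,
      (@lebesgue_measure R).-integrable `[0, tau]
        (fun t => (dot (y2 t) (u2 t))%:E),
      delivered2 tau u2 y2 <= dot e1h dxh + dot e1c dxc /\
      dot e1h dxh + dot e1c dxc = dot (e1h - e1c) dxh,
      (R1_zero -> R2_zero ->
        delivered2 tau u2 y2 = dot e1h dxh + dot e1c dxc) &
      (R1_zero -> R2_zero -> n1 = 1%N -> dot e1h dxh != 0 ->
        efficiency tau e1h dxh u2 y2
          = (dot e1h dxh + dot e1c dxc) / dot e1h dxh /\
        forall i : 'I_n1,
          (dot e1h dxh + dot e1c dxc) / dot e1h dxh
            = 1 - e1c i 0 / e1h i 0)].
Proof.
move=> dxh dxc R1_zero R2_zero.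
have [tau01 tau12 tau23 tau3t] := cc_times cycle.
have tau0 : 0 <= tau by lra.
have sol := cc_solution cycle.
have [v1 v1E] := sol_ac1 sol; have [v2 v2E] := sol_ac2 sol.
have [x1per x2per] := cc_closed cycle.
have dx0 : dxh + dxc = 0.
  (* The adiabatics give [x1 tau1 = x1 tau2] and [x1 tau3 = x1 tau], and the cycle closes, so the
     two increments cancel. *)
  rewrite /dxh /dxc -(cc_adiabatic1 cycle (t := tau2)) ?in_itv /= ?tau12 ?lexx//.
  rewrite -(cc_adiabatic2 cycle (t := tau)) ?in_itv /= ?tau3t ?lexx// x1per.
  by rewrite addrC subrKA subrr.
have dxcE : dxc = - dxh by apply/eqP; rewrite -addr_eq0 addrC dx0.
have balance : delivered2 tau u2 y2 = dot e1h dxh + dot e1c dxc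
    - \int[@lebesgue_measure R]_(t in `[0, tau]) dissipation2 S x1 x2 t.
  (* The state returns to its initial value, so the stored energy [H] drops out. *)
  rewrite (ph_energy_balance tau0 sol v1E v2E) x1per x2per subrr subr0.
  by rewrite (carnot_isotherm_energy cycle v1E (integrable_dot_e1 tau0 sol v1E v2E)).
have lossless : R2_zero -> delivered2 tau u2 y2 = dot e1h dxh + dot e1c dxc.
  move=> R20; rewrite balance (_ : Rintegral _ _ _ = 0) ?subr0//.
  rewrite -[RHS](mul0r (fine (@lebesgue_measure R `[0, tau]))) -Rintegral_cst//.
  apply: eq_Rintegral => t /set_mem /= tin.
  by rewrite /dissipation2 R20 ?mul0mx /dot ?mulmx0 ?mxE//; exact: (sol_X sol).
split => //.
- exact: integrable_port2 tau0 sol v1E v2E.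
- split; last by rewrite dxcE dotDl dotNl dotNr.
  (* The gap in the inequality is exactly the dissipated energy. *)
  rewrite balance gerBl; apply: Rintegral_ge0 => t tin.
  by apply: (dissipation2_ge0 sol tin).
move=> _ R20 n11 supply_neq0; split; first by rewrite /efficiency lossless.
move=> i; move: supply_neq0; rewrite dxcE dotNr !dotE.
(* Since [n1 = 1], the index [i] is the only one and each dot product is a single product. *)
have sum1 (F : 'I_n1 -> R) : \sum_k F k = F i.
  by rewrite (bigD1 i)//= big1 ?addr0// => k; subst n1; rewrite (ord1 k) (ord1 i) eqxx.
(* The nonzero supply makes both [e1h] and [dxh] nonzero, as the division requires. *)
rewrite !sum1 mulf_eq0 negb_or => /andP[e1h0 dxh0].
by field; rewrite e1h0 dxh0.
Qed.
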